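(* Let $V$ be a locally linearly compact vector space over a discrete field $\mathbb K$ and let $\phi\colon V\to V$ be a continuous endomorphism. Assume that $V$ is the direct limit of a family $\{V_i\mid i\in I\}$ of closed $\phi$-invariant linear subspaces of $V$ (i.e. the family is directed under inclusion and $V=\bigcup_{i\in I}V_i$), and let $\phi_i=\phi\restriction_{V_i}$ for all $i\in I$. Then $\mathrm{ent}(\phi)=\sup_{i\in I}\mathrm{ent}(\phi_i)$.
   Context: $\mathbb K$ is an arbitrary field endowed with the discrete topology. A topological vector space over $\mathbb K$ is linearly topologized if it is Hausdorff and has a neighborhood basis at $0$ consisting of linear subspaces. A linear variety of $V$ is a coset $v+W$ of a linear subspace $W$; it is closed (open) if $W$ is closed (open). A linearly topologized vector space is linearly compact if every collection of closed linear varieties with the finite intersection property has non-empty intersection. A linearly topologized vector space is locally linearly compact (l.l.c.) if it has an open linear subspace that is linearly compact; $\mathcal B(V)$ denotes the family of all linearly compact open linear subspaces of $V$. A closed linear subspace of an l.l.c. space is l.l.c. with the induced topology. A linear subspace $W$ is $\phi$-invariant if $\phi W\leq W$. ''Endomorphism'' means linear endomorphism. For a continuous endomorphism $\phi$ of an l.l.c. space $V$, $U\in\mathcal B(V)$ and a positive integer $n$, let $T_n(\phi,U)=U+\phi U+\dots+\phi^{n-1}U$. Define $H(\phi,U)=\lim_{n\to\infty}\frac1n\dim\frac{T_n(\phi,U)}{U}$ (the limit exists) and $\mathrm{ent}(\phi)=\sup\{H(\phi,U)\mid U\in\mathcal B(V)\}\in\mathbb N\cup\{\infty\}$. *)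

(* Defs.v *)
From HB Require Import structures.
From mathcomp Require Import all_boot all_order all_algebra.
From mathcomp Require Import generic_quotient ring_quotient.
From mathcomp Require Import all_classical all_reals all_analysis.

Set Implicit Arguments.
Unset Strict Implicit.
Unset Printing Implicit Defensive.

Import Order.TTheory GRing.Theory Num.Theory.

Local Open Scope classical_set_scope.
Local Open Scope quotient_scope.
Local Open Scope ring_scope.

(* [topologicalLmodType] from the library asks for a normed scalar domain,
   whence this structure for an arbitrary field with the discrete topology.
   It is not an HB structure because HB forces any join of [Topological] and
   [GRing.Lmodule K] to be compatible with [PreTopologicalLmodule], whose
   scalars are a [numDomainType]. *)
Record discTopLmodType (K : fieldType) := DiscTopLmod {
  disc_sort : Type ;
  disc_class : TopologicalZmodule.axioms_ disc_sort ;
  disc_lmod : GRing.Nmodule_isLSemiModule K (TopologicalZmodule.Pack disc_class) ;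
  disc_scale_continuous_subproof : continuous
    (fun z : discrete_topology K * TopologicalZmodule.Pack disc_class =>
      GRing.Nmodule_isLSemiModule.scale disc_lmod z.1 z.2) ;
}.
#[reversible] Coercion disc_sort : discTopLmodType >-> Sortclass.

HB.instance Definition _ (K : fieldType) (V : discTopLmodType K) :=
  TopologicalZmodule.copy (disc_sort V) (TopologicalZmodule.Pack (disc_class V)).
HB.instance Definition _ (K : fieldType) (V : discTopLmodType K) :=
  (disc_lmod V : GRing.Nmodule_isLSemiModule K (disc_sort V)).

Lemma disc_scale_continuous (K : fieldType) (V : discTopLmodType K) :
  continuous (fun z : discrete_topology K * V => (z.1 : K) *: z.2).
Proof. exact: disc_scale_continuous_subproof. Qed.

(* Linear subspaces of V are the elements of [submodClosed V]. *)

Section SubspaceAlgebra.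
Variables (K : fieldType) (V : lmodType K).

Definition subspaceType (W : submodClosed V) : Type := {x : V | x \in W}.

Section Instances.
Variable W : submodClosed V.

HB.instance Definition _ := SubType.copy (subspaceType W) {x : V | x \in W}.
HB.instance Definition _ := [Choice of subspaceType W by <:].
HB.instance Definition _ := [SubChoice_isSubLmodule of subspaceType W by <:].

End Instances.

Section Restriction.
Variables (phi : {linear V -> V}) (W : submodClosed V).

Definition invariant_subspace : Prop := forall x, x \in W -> phi x \in W.

Variable phiW : invariant_subspace.

Definition restrict_endo (x : subspaceType W) : subspaceType W :=
  Sub (phi (\val x)) (phiW (valP x)).

Fact restrict_endo_is_linear : linear restrict_endo.
Proof. by move=> a u v; apply: val_inj; rewrite /= !linearP. Qed.

HB.instance Definition _ := GRing.isLinear.Build K _ _ _ restrict_endo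
  restrict_endo_is_linear.

End Restriction.

Section Quotient.
Variable U : submodClosed V.

Definition zmod_of_submod : zmodClosed V :=
  HB.pack_for (zmodClosed V) (U : {pred V})
    (GRing.isZmodClosed.Build V (U : {pred V})
      (GRing.submod_closedB (GRing.submodClosedP U))).

Local Notation Q := (Quotient.quot zmod_of_submod).

Definition quotSpace : Type := Q.

HB.instance Definition _ := GRing.Zmodule.copy quotSpace Q.

Definition quotSpace_pi (x : V) : quotSpace := \pi_Q x.
Definition quotSpace_repr (q : quotSpace) : V := repr (q : Q).

Fact quotSpace_reprK q : quotSpace_pi (quotSpace_repr q) = q.
Proof. exact: reprK. Qed.

Fact quotSpace_piE x y : quotSpace_pi x = quotSpace_pi y <-> x - y \in U.
Proof.
by split=> [/eqP|Uxy]; [|apply/eqP]; rewrite -(Quotient.idealrBE zmod_of_submod).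
Qed.

Fact quotSpace_piD x y : quotSpace_pi (x + y) = quotSpace_pi x + quotSpace_pi y.
Proof. by rewrite /quotSpace_pi; exact: (raddfD \pi_Q). Qed.

Definition quotSpace_scale (a : K) (q : quotSpace) : quotSpace :=
  quotSpace_pi (a *: quotSpace_repr q).

Fact quotSpace_piZ a x : quotSpace_scale a (quotSpace_pi x) = quotSpace_pi (a *: x).
Proof.
by apply/quotSpace_piE; rewrite -scalerBr rpredZ//; apply/quotSpace_piE;
  rewrite quotSpace_reprK.
Qed.

Fact quotSpace_scaleA a b q :
  quotSpace_scale a (quotSpace_scale b q) = quotSpace_scale (a * b) q.
Proof. by rewrite -(quotSpace_reprK q) !quotSpace_piZ scalerA. Qed.

Fact quotSpace_scale1 : left_id 1 quotSpace_scale.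
Proof. by move=> q; rewrite -(quotSpace_reprK q) quotSpace_piZ scale1r. Qed.

Fact quotSpace_scaleDr : right_distributive quotSpace_scale +%R.
Proof.
move=> a p q; rewrite -(quotSpace_reprK p) -(quotSpace_reprK q) !quotSpace_piZ.
by rewrite -!quotSpace_piD quotSpace_piZ scalerDr.
Qed.

Fact quotSpace_scaleDl q : {morph quotSpace_scale^~ q : a b / a + b}.
Proof.
by move=> a b; rewrite -(quotSpace_reprK q) !quotSpace_piZ -quotSpace_piD scalerDl.
Qed.

HB.instance Definition _ := GRing.Zmodule_isLmodule.Build K quotSpace
  quotSpace_scaleA quotSpace_scale1 quotSpace_scaleDr quotSpace_scaleDl.

End Quotient.

End SubspaceAlgebra.
Arguments restrict_endo {K V phi W} phiW x.

Section Subquotient.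
Variables (K : fieldType) (V : lmodType K) (T U : submodClosed V).

Definition trace_pred : {pred subspaceType T} := [pred t | \val t \in U].

Fact trace_submod : submod_closed trace_pred.
Proof.
split=> [|a u v]; rewrite !inE; first by rewrite raddf0 rpred0.
by move=> uU vU; rewrite linearP rpredD// rpredZ.
Qed.

HB.instance Definition _ := GRing.isSubmodClosed.Build K _ trace_pred
  trace_submod.

(* T / U, meant for U included in T (in general, T / (T `&` U)). *)
Definition subquotient : lmodType K := quotSpace (trace_pred : submodClosed _).

End Subquotient.

Section Trajectory.
Variables (K : fieldType) (V : lmodType K) (phi : {linear V -> V}).
Variables (U : submodClosed V) (n : nat).

Definition trajectory_pred : {pred V} := fun x =>
  `[< exists2 u : 'I_n -> V, (forall k, u k \in U) &
        x = \sum_(k < n) iter k phi (u k) >].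

Fact trajectory_submod : submod_closed trajectory_pred.
Proof.
have iterP k a x y :
    iter k phi (a *: x + y) = a *: iter k phi x + iter k phi y.
  by elim: k => //= k ->; rewrite linearP.
split=> [|a x y]; rewrite !unfold_in.
  apply/asboolP; exists (fun=> 0) => [k|]; first exact: rpred0.
  by rewrite big1// => k _; elim: (nat_of_ord k) => //= m ->; rewrite linear0.
move=> /asboolP[u uU ->] /asboolP[v vU ->]; apply/asboolP.
exists (fun k => a *: u k + v k) => [k|]; first by rewrite rpredD ?rpredZ.
by rewrite scaler_sumr -big_split; apply: eq_bigr => k _; rewrite iterP.
Qed.

HB.instance Definition _ := GRing.isSubmodClosed.Build K V trajectory_pred
  trajectory_submod.

Definition trajectory : submodClosed V := trajectory_pred.

End Trajectory.

Section Dimension.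
Variables (K : fieldType) (V : lmodType K).

Definition is_basis n (e : 'I_n -> V) : Prop :=
  (forall c : 'I_n -> K, \sum_i c i *: e i = 0 -> forall i, c i = 0) /\
  (forall v : V, exists c : 'I_n -> K, v = \sum_i c i *: e i).

(* The infimum is over a singleton when V is finite-dimensional, and over the
   empty set (thus +oo) otherwise. *)
Definition dimension (R : realType) : \bar R :=
  ereal_inf [set n%:R%:E | n in [set n | exists e : 'I_n -> V, is_basis e]].

End Dimension.

Section SubspaceTopology.
Variables (K : fieldType) (V : discTopLmodType K) (W : submodClosed V).

HB.instance Definition _ := Topological.copy (subspaceType W)
  (initial_topology (\val : subspaceType W -> V)).

Fact subspace_val_continuous : continuous (\val : subspaceType W -> V).
Proof. exact: (@initial_continuous _ _ (\val : subspaceType W -> V)). Qed.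

Fact continuous_subspace (T : topologicalType) (f : T -> subspaceType W) :
  continuous (\val \o f) -> continuous f.
Proof.
by move=> /continuousP cf; apply/continuousP => _ [B oB <-]; exact: cf.
Qed.

Fact subspace_add_continuous :
  continuous (fun z : subspaceType W * subspaceType W => z.1 + z.2).
Proof.
apply: continuous_subspace => z.
apply: (@continuous_comp _ _ _
  (fun z : subspaceType W * subspaceType W => (\val z.1, \val z.2))
  (fun z : V * V => z.1 + z.2)); last exact: add_continuous.
by apply: cvg_pair => /=; apply: continuous_comp;
  [exact: cvg_fst|exact: subspace_val_continuous
  |exact: cvg_snd|exact: subspace_val_continuous].
Qed.

HB.instance Definition _ := PreTopologicalNmodule_isTopologicalNmodule.Build
  (subspaceType W) subspace_add_continuous.

Fact subspace_opp_continuous : continuous (-%R : subspaceType W -> _).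
Proof.
apply: continuous_subspace => z.
rewrite (_ : _ \o _ = (-%R : V -> V) \o \val); last first.
  by apply/funext => x; exact: (raddfN (\val : subspaceType W -> V)).
by apply: continuous_comp; [exact: subspace_val_continuous|exact: opp_continuous].
Qed.

HB.instance Definition _ := TopologicalNmodule_isTopologicalZmodule.Build
  (subspaceType W) subspace_opp_continuous.

Fact subspace_scale_continuous : continuous
  (fun z : discrete_topology K * subspaceType W => z.1 *: z.2).
Proof.
apply: continuous_subspace => z.
apply: (@continuous_comp _ _ _
  (fun z : discrete_topology K * subspaceType W => (z.1, \val z.2))
  (fun z : discrete_topology K * V => z.1 *: z.2)); last first.
  exact: disc_scale_continuous.
apply: (@cvg_pair _ _ _ _ (nbhs (z.1 : discrete_topology K))) => /=.
  exact: cvg_fst.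
by apply: continuous_comp; [exact: cvg_snd|exact: subspace_val_continuous].
Qed.

Canonical subspace_discTopLmodType : discTopLmodType K :=
  @DiscTopLmod K (subspaceType W) (TopologicalZmodule.class (subspaceType W))
    (GRing.Lmodule.GRing_Nmodule_isLSemiModule_mixin
      (GRing.Lmodule.class (subspaceType W)))
    subspace_scale_continuous.

End SubspaceTopology.

Section LinearCompactness.
Variables (K : fieldType) (V : discTopLmodType K).

Definition linearly_topologized : Prop :=
  hausdorff_space V /\
  forall N : set V, nbhs 0 N ->
    exists2 W : submodClosed V, nbhs (0 : V) [set` W] & [set` W] `<=` N.

Definition closed_linear_variety (A : set V) : Prop :=
  exists (v : V) (W : submodClosed V),
    closed [set` W] /\ A = [set v + w | w in [set` W]].

Definition linearly_compact : Prop :=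
  linearly_topologized /\
  forall F : set (set V), (forall A, F A -> closed_linear_variety A) ->
    finI F id -> \bigcap_(A in F) A !=set0.

End LinearCompactness.

Definition lc_open_subspaces (K : fieldType) (V : discTopLmodType K) :
    set (submodClosed V) :=
  [set U : submodClosed V | open [set` U] /\ linearly_compact (subspaceType U)].
Arguments lc_open_subspaces {K} V.

Definition locally_linearly_compact (K : fieldType) (V : discTopLmodType K) :
    Prop :=
  linearly_topologized V /\ lc_open_subspaces V !=set0.

Section Entropy.
Variables (R : realType) (K : fieldType) (V : discTopLmodType K).
Variable phi : {linear V -> V}.

(* The term n = 0 is irrelevant to the limit. *)
Definition entropy_at (U : submodClosed V) : \bar R :=
  limn (fun n : nat =>
    ((n%:R^-1)%:E * dimension (subquotient (trajectory phi U n) U) R)%E).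

Definition ent : \bar R :=
  ereal_sup [set entropy_at U | U in lc_open_subspaces V].

End Entropy.

Definition directed_family (K : fieldType) (V : lmodType K) (I : Type)
    (Vs : I -> submodClosed V) : Prop :=
  forall i j, exists k, {subset Vs i <= Vs k} /\ {subset Vs j <= Vs k}.

(* Main.v *)
Require Import Defs.
From HB Require Import structures.
From mathcomp Require Import all_boot all_order all_algebra.
From mathcomp Require Import all_classical all_reals all_analysis.

(* Both inequalities compare U in B(V) with its trace on W = V_i: the map
   T_n(phi_i, U :&: W) / (U :&: W) -> T_n(phi, U) / U is always injective.
   - Every U' in B(W) is the trace of some U in B(V) (modular law applied to
     U' + U0 for a small U0 in B(V)), whence ent(phi_i) <= ent(phi).
   - U is linearly compact and its subspace of points that phi maps into U is
     open, hence of finite codimension in U. So U + phi U = U + phi G with G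
     included in U of finite dimension; G is included in some V_i by
     directedness, and then the above map is surjective for all n.
   The limits exist because phi maps T_{n+1} / T_n onto T_{n+2} / T_{n+1}, so
   that the dimensions of these quotients are nonincreasing and Cesaro's lemma
   applies. *)

Set Implicit Arguments.
Unset Strict Implicit.
Unset Printing Implicit Defensive.

Import Order.TTheory GRing.Theory Num.Theory.
Import numFieldNormedType.Exports.

Local Open Scope classical_set_scope.
Local Open Scope ring_scope.

(** * Relative dimension *)

Section SubmodOfSet.
Variables (K : fieldType) (V : lmodType K) (P : set V).
Hypotheses (P0 : P 0) (PL : forall a x y, P x -> P y -> P (a *: x + y)).

(** The closure proofs are arguments of the predicate, so that the structure declared on it can
    recover them by unification. *)
Definition submod_pred of P 0 & (forall a x y, P x -> P y -> P (a *: x + y)) :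
  {pred V} := fun x => `[< P x >].

Fact submod_pred_closed : submod_closed (submod_pred P0 PL).
Proof.
split=> [|a x y]; rewrite !unfold_in; first exact/asboolP.
by move=> /asboolP Px /asboolP Py; apply/asboolP; exact: PL.
Qed.

HB.instance Definition _ := GRing.isSubmodClosed.Build K V (submod_pred P0 PL)
  submod_pred_closed.

Definition submod_of : submodClosed V := submod_pred P0 PL.

Lemma submod_ofP x : x \in submod_of <-> P x.
Proof. by split=> [/asboolP|/asboolP]. Qed.

End SubmodOfSet.

Section SubmodOpp.
Variables (K : fieldType) (V : lmodType K) (U : submodClosed V).

(* [submodClosed] does not inherit from [zmodClosed], whence no [rpredN]. *)
Lemma submodN x : x \in U -> - x \in U.
Proof. by move=> xU; rewrite -scaleN1r rpredZ. Qed.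

Lemma submodB x y : x \in U -> y \in U -> x - y \in U.
Proof. by move=> xU yU; rewrite rpredD ?submodN. Qed.

Lemma submodBC x y : x - y \in U -> y - x \in U.
Proof. by move/submodN; rewrite opprB. Qed.

Lemma submodBr x y : x - y \in U -> y \in U -> x \in U.
Proof. by move=> xyU /(rpredD xyU); rewrite subrK. Qed.

Lemma submodBl x y : x - y \in U -> x \in U -> y \in U.
Proof. by move/submodBC; exact: submodBr. Qed.

End SubmodOpp.

Section RelativeDimension.
Variables (K : fieldType) (V : lmodType K).
Implicit Types (U T S : submodClosed V).

Definition free_mod U n (e : 'I_n -> V) :=
  forall c : 'I_n -> K, \sum_i c i *: e i \in U -> forall i, c i = 0.

Definition spans_mod U (T : set V) n (e : 'I_n -> V) :=
  forall x, T x -> exists c : 'I_n -> K, x - \sum_i c i *: e i \in U.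

(** Representatives in [V] replace a basis of the quotient. For arbitrary [U] and [T] this is the
    dimension of (T + U) / U. *)
Definition rel_dim U T n := exists e : 'I_n -> V,
  [/\ forall i, e i \in T, free_mod U e & spans_mod U [set` T] e].

(** Steinitz bound: if m < n, the n by m matrix expressing [e] through [f] modulo [U] has a nonzero
    row in its left kernel, which is a relation among the [e i]. *)
Lemma free_mod_leq U n m (e : 'I_n -> V) (f : 'I_m -> V) :
  free_mod U e -> spans_mod U (range e) f -> (n <= m)%N.
Proof.
move=> fe sf; rewrite leqNgt; apply/negP => ltmn.
have /choice[A eA] : forall i, exists c : 'I_m -> K,
    e i - \sum_j c j *: f j \in U by move=> i; apply: sf; exists i.
pose M : 'M[K]_(n, m) := \matrix_(i, j) A i j.
have : kermx M != 0.
  rewrite kermx_eq0 /row_free; apply/eqP => rM.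
  by move: (rank_leq_col M); rewrite rM leqNgt ltmn.
case/rowV0Pn => v /sub_kermxP vM /eqP; apply.
apply/rowP => i; rewrite mxE; apply: (fe (v 0)).
(* As [v] kills the matrix, removing the [f]-parts does not change the sum, and each remaining
   difference lies in [U]. *)
have -> : \sum_i v 0 i *: e i =
    \sum_i v 0 i *: (e i - \sum_j A i j *: f j).
  rewrite -[LHS]subr0; under [RHS]eq_bigr do rewrite scalerBr scaler_sumr.
  rewrite sumrB; congr (_ - _); rewrite exchange_big big1//= => j _.
  under eq_bigr do rewrite scalerA.
  rewrite -scaler_suml; have /rowP/(_ j) := vM; rewrite !mxE => vMj.
  rewrite (_ : \sum_i _ = 0) ?scale0r// -[RHS]vMj.
  by apply: eq_bigr => k _; rewrite mxE.
by apply: rpred_sum => k _; rewrite rpredZ.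
Qed.

Lemma free_spans_leq U T n m (e : 'I_n -> V) (f : 'I_m -> V) :
  (forall i, e i \in T) -> free_mod U e -> spans_mod U [set` T] f -> (n <= m)%N.
Proof.
by move=> eT fe sf; apply: (free_mod_leq fe) => _ [i _ <-]; exact: sf (eT i).
Qed.

Lemma rel_dim_uniq U T n m : rel_dim U T n -> rel_dim U T m -> n = m.
Proof.
move=> [e [eT fe se]] [f [fT ff sf]]; apply/eqP.
by rewrite eqn_leq (free_spans_leq eT fe sf) (free_spans_leq fT ff se).
Qed.

Lemma free_mod_extend U n (e : 'I_n -> V) x :
  free_mod U e -> (forall c : 'I_n -> K, x - \sum_i c i *: e i \notin U) ->
  free_mod U (fun i : 'I_n.+1 => oapp e x (unlift ord0 i)).
Proof.
move=> fe xe c; rewrite big_ord_recl unlift_none /=.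
under eq_bigr do rewrite liftK /=.
have [c0|c0] := eqVneq (c ord0) 0.
  rewrite c0 scale0r add0r => /fe ce i.
  by case: (unliftP ord0 i) => [j|] ->.
move=> cU; case/negP: (xe (fun i => - (c ord0)^-1 * c (lift ord0 i))).
rewrite (_ : _ - _ = (c ord0)^-1 *: (c ord0 *: x +
    \sum_(i < n) c (lift ord0 i) *: e i)) ?rpredZ//.
rewrite scalerDr scalerA mulVf// scale1r scaler_sumr; congr (_ + _).
by rewrite -sumrN; apply: eq_bigr => i _; rewrite scalerA mulNr scaleNr opprK.
Qed.

(** The size of a free family of [T] is at most [m]. One of maximal size spans, since a vector it
    misses would extend it. *)
Lemma spans_rel_dim U T m (f : 'I_m -> V) :
  spans_mod U [set` T] f -> exists n, rel_dim U T n.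
Proof.
move=> sf.
pose P n := `[< exists2 e : 'I_n -> V, (forall i, e i \in T) & free_mod U e >].
have P0 : exists n, P n.
  by exists 0%N; apply/asboolP; exists (fun=> 0) => [[]//|c _ []].
have Pm n : P n -> (n <= m)%N by move=> /asboolP[e eT fe]; exact: free_spans_leq sf.
case: (ex_maxnP P0 Pm) => n /asboolP[e eT fe] nmax; exists n, e; split=> // x xT.
apply: contrapT => /forallNP xe.
have : P n.+1.
  apply/asboolP; exists (fun i => oapp e x (unlift ord0 i)) => [i|].
    by case: (unliftP ord0 i) => [j|] _ /=.
  by apply: free_mod_extend => // c; apply/negP/xe.
by move/nmax; rewrite ltnn.
Qed.

(** The two bases are concatenated. In a relation modulo [U], reduction modulo [T] first kills the
    coefficients of [f], then freeness of [e] kills the others. *)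
Lemma rel_dim_add U T S n m : {subset U <= T} -> {subset T <= S} ->
  rel_dim U T n -> rel_dim T S m -> rel_dim U S (n + m).
Proof.
move=> UT TS [e [eT fe se]] [f [fS ff sf]].
pose g (i : 'I_(n + m)) :=
  match fintype.split i with inl j => e j | inr j => f j end.
have gl j : g (lshift m j) = e j by rewrite /g (unsplitK (inl j)).
have gr j : g (rshift n j) = f j by rewrite /g (unsplitK (inr j)).
have sumg c : \sum_i c i *: g i = \sum_j c (lshift m j) *: e j +
    \sum_j c (rshift n j) *: f j.
  by rewrite big_split_ord; congr (_ + _); apply: eq_bigr => j _; rewrite ?gl ?gr.
have eTs (c : 'I_n -> K) : \sum_j c j *: e j \in T.
  by apply: rpred_sum => j _; rewrite rpredZ.
exists g; split=> [i|c|x xS].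
- by rewrite /g; case: fintype.splitP => j _; [exact: TS|].
- rewrite sumg => cU.
  have cf : forall j, c (rshift n j) = 0.
    apply: ff; have := submodB (UT _ cU) (eTs (c \o lshift m)).
    by rewrite [X in X - _]addrC addrK.
  move: cU; rewrite [X in _ + X]big1 ?addr0; last by move=> j _; rewrite cf scale0r.
  move=> /fe ce i; case: (fintype.splitP i) => j ij.
    by rewrite (_ : i = lshift m j) ?ce//; exact: val_inj.
  by rewrite (_ : i = rshift n j) ?cf//; exact: val_inj.
- have [b xb] := sf _ xS; have [a xa] := se _ xb.
  pose h (i : 'I_(n + m)) :=
    match fintype.split i with inl j => a j | inr j => b j end.
  exists h; rewrite sumg.
  under [X in _ - (X + _)]eq_bigr do rewrite /h (unsplitK (inl _)).
  under [X in _ - (_ + X)]eq_bigr do rewrite /h (unsplitK (inr _)).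
  by rewrite opprD addrA addrAC.
Qed.

End RelativeDimension.

Section Transport.
Variables (K : fieldType) (V W : lmodType K) (f : {linear V -> W}).

Lemma linear_combination n (c : 'I_n -> K) (e : 'I_n -> V) :
  f (\sum_i c i *: e i) = \sum_i c i *: f (e i).
Proof. by rewrite linear_sum; apply: eq_bigr => i _; rewrite linearZ. Qed.

Variables (U T : submodClosed V) (U' T' : submodClosed W) (n m : nat).
Hypotheses (dn : rel_dim U T n) (dm : rel_dim U' T' m).

(** The map from T / U to T' / U' is injective in the sense that [f] carries a free family to a free
    family. *)
Lemma rel_dim_inj : {in T, forall x, f x \in T'} ->
  (forall x, f x \in U' -> x \in U) -> (n <= m)%N.
Proof.
move=> fT fU; have [e [eT fe _]] := dn; have [g [_ _ sg]] := dm.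
apply: (@free_spans_leq _ _ U' T' _ _ (f \o e) g) => // [i|c].
  exact: fT.
by rewrite /= -linear_combination => /fU /fe.
Qed.

(** The image under [f] of a basis of [T] modulo [U] spans [T'] modulo [U']. *)
Lemma rel_dim_surj : {in U, forall x, f x \in U'} ->
  {in T', forall y, exists2 x, x \in T & y - f x \in U'} -> (m <= n)%N.
Proof.
move=> fU fT; have [e [_ _ se]] := dn; have [g [gT fg _]] := dm.
apply: (@free_spans_leq _ _ U' T' _ _ g (f \o e)) => // y yT.
have [x xT yx] := fT _ yT; have [c xc] := se _ xT; exists c.
rewrite -linear_combination -[y](subrK (f x)) -addrA -raddfB rpredD//.
exact: fU.
Qed.

End Transport.

Section DimensionSubquotient.
Variables (R : realType) (K : fieldType) (V : lmodType K).
Variables (T U : submodClosed V).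

Lemma rel_dim_basis n :
  rel_dim U T n <-> exists q : 'I_n -> subquotient T U, is_basis q.
Proof.
pose N : submodClosed (subspaceType T) := trace_pred U.
have p0 : quotSpace_pi N 0 = 0.
  by apply: (addIr (quotSpace_pi N 0)); rewrite -quotSpace_piD !add0r.
have piE k (c : 'I_k -> K) (t : 'I_k -> subspaceType T) :
    quotSpace_pi N (\sum_i c i *: t i) =
    \sum_i c i *: (quotSpace_pi N (t i) : subquotient T U).
  rewrite (big_morph (quotSpace_pi N) (@quotSpace_piD _ _ N) p0).
  by apply: eq_bigr => i _; rewrite -quotSpace_piZ.
have pi0P x : x \in N -> quotSpace_pi N x = 0.
  move=> xN; rewrite -p0; apply/quotSpace_piE.
  by rewrite subr0.
have valE k (c : 'I_k -> K) (t : 'I_k -> subspaceType T) :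
    \val (\sum_i c i *: t i) = \sum_i c i *: \val (t i).
  exact: linear_combination.
split=> [[e [eT fe se]]|[q [fq sq]]].
  pose t i : subspaceType T := Sub (e i) (eT i).
  exists (fun i => quotSpace_pi N (t i)); split=> [c|v].
    rewrite -piE => c0; apply: fe.
    by move: c0; rewrite -p0 => /quotSpace_piE; rewrite subr0 inE valE.
  have [c xc] := se _ (valP (quotSpace_repr v)).
  exists c; rewrite -piE -[v in LHS]quotSpace_reprK; apply/quotSpace_piE.
  by rewrite inE raddfB /= valE.
pose t i := quotSpace_repr (q i).
have qt i : q i = quotSpace_pi N (t i) by rewrite quotSpace_reprK.
exists (fun i => \val (t i)); split=> [i|c|x xT]; first exact: valP.
  rewrite -valE => cU; apply: fq.
  under eq_bigr do rewrite qt.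
  by rewrite -piE pi0P// inE.
have [c xc] := sq (quotSpace_pi N (Sub x xT)); exists c.
move: xc; under eq_bigr do rewrite qt.
by rewrite -piE => /quotSpace_piE; rewrite inE raddfB /= valE.
Qed.

Lemma dimension_subquotient n :
  rel_dim U T n -> dimension (subquotient T U) R = n%:R%:E.
Proof.
move=> dn; rewrite /dimension (_ : [set _ | _ in _] = [set n%:R%:E]) ?ereal_inf1//.
apply/seteqP; split=> [_ [m /rel_dim_basis dm <-]|_ ->]; last first.
  by exists n => //; exact/rel_dim_basis.
by rewrite (rel_dim_uniq dm dn).
Qed.

End DimensionSubquotient.

(** * Trajectories *)

Section LinearIter.
Variables (K : fieldType) (V : lmodType K) (phi : {linear V -> V}).

Lemma iter_linearP k a x y :
  iter k phi (a *: x + y) = a *: iter k phi x + iter k phi y.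
Proof. by elim: k => //= k ->; rewrite linearP. Qed.

Lemma iter_linearB k x y : iter k phi (x - y) = iter k phi x - iter k phi y.
Proof. by rewrite [x - y]addrC -scaleN1r iter_linearP scaleN1r addrC. Qed.

Lemma iter_linear0 k : iter k phi 0 = 0.
Proof. by elim: k => //= k ->; rewrite linear0. Qed.

Lemma iter_linear_comb k n (c : 'I_n -> K) (e : 'I_n -> V) :
  iter k phi (\sum_i c i *: e i) = \sum_i c i *: iter k phi (e i).
Proof. by elim: k => //= k ->; exact: linear_combination. Qed.

End LinearIter.

Section PreimageSubmod.
Variables (K : fieldType) (V W : lmodType K) (f : {linear V -> W}).
Variable U : submodClosed W.

(** Kept transparent, so that lemmas about [submod_of] apply to it by conversion. *)
Definition preim_submod : submodClosed V.
Proof.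
refine (@submod_of _ _ [set x | f x \in U] _ _); first by rewrite /= raddf0 rpred0.
by move=> a x y /= xU yU; rewrite linearP rpredD ?rpredZ.
Defined.

Lemma preim_submodP x : x \in preim_submod <-> f x \in U.
Proof. exact: submod_ofP. Qed.

End PreimageSubmod.

Section TrajectoryDimension.
Variables (K : fieldType) (V : lmodType K) (phi : {linear V -> V}).
Variable U : submodClosed V.
Local Notation T := (trajectory phi U).

(** The last summand is split off, which allows inductions on [n] without sums indexed by
    ordinals. *)
Lemma trajectoryS n x : x \in T n.+1 <->
  exists t u, [/\ t \in T n, u \in U & x = t + iter n phi u].
Proof.
split=> [/asboolP[u uU ->]|[t [u [/asboolP[v vU ->] uU ->]]]].
  rewrite big_ord_recr /=; eexists; eexists; split; [|exact: (uU ord_max)|by []].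
  by apply/asboolP; exists (fun k => u (widen_ord (leqnSn n) k)).
apply/asboolP; exists (fun k => if unlift ord_max k is Some j then v j else u).
  by move=> k; case: unlift.
rewrite big_ord_recr /= unlift_none; congr (_ + _).
apply: eq_bigr => k _; rewrite (_ : widen_ord _ _ = lift ord_max k) ?liftK//.
by apply: val_inj; rewrite /= /bump leqNgt ltn_ord.
Qed.

Lemma trajectory0 x : x \in T 0 <-> x = 0.
Proof.
split=> [/asboolP[u _ ->]|->]; first by rewrite big_ord0.
exact: rpred0.
Qed.

Lemma trajectory1 x : x \in T 1 <-> x \in U.
Proof.
split=> [/trajectoryS[t [u [/trajectory0 -> uU ->]]]|xU]; first by rewrite add0r.
by apply/trajectoryS; exists 0, x; rewrite add0r; split=> //; exact/trajectory0.
Qed.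

Lemma trajectory_subS n : {subset T n <= T n.+1}.
Proof.
move=> x xT; apply/trajectoryS; exists x, 0.
by rewrite iter_linear0 addr0 rpred0.
Qed.

Lemma sub_trajectoryS n : {subset U <= T n.+1}.
Proof.
elim: n => [|n IH] x xU; first exact/trajectory1.
exact/trajectory_subS/IH.
Qed.

Lemma iter_trajectory n x : x \in U -> iter n phi x \in T n.+1.
Proof.
by move=> xU; apply/trajectoryS; exists 0, x; rewrite add0r rpred0.
Qed.

Lemma trajectory_endo n x : x \in T n -> phi x \in T n.+1.
Proof.
elim: n x => [|n IH] x; first by move/trajectory0 ->; rewrite linear0 rpred0.
case/trajectoryS => t [u [tT uU ->]]; rewrite linearD rpredD//.
  exact/trajectory_subS/IH.
exact: (@iter_trajectory n.+1).
Qed.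

Variables (p : nat) (e : 'I_p -> V).
Hypothesis spans_e : spans_mod (preim_submod phi U) [set` U] e.

(** The remainder of [u] modulo the span of [e] is sent into [U] by [phi], so one of the n + 1
    iterations is absorbed. *)
Lemma trajectory_split n u : u \in U ->
  exists c : 'I_p -> K, iter n.+1 phi (u - \sum_i c i *: e i) \in T n.+1.
Proof.
move=> uU; have [c /preim_submodP uc] := spans_e uU; exists c.
by rewrite iterSr; exact: iter_trajectory.
Qed.

Lemma rel_dim_trajectoryS n : exists d, rel_dim (T n.+1) (T n.+2) d.
Proof.
(* The iterates of the [e i] span, since the remainder of [u] only contributes to T_(n+1). *)
apply: (@spans_rel_dim _ _ _ _ _ (fun i => iter n.+1 phi (e i))) => x.
case/trajectoryS => t [u [tT uU ->]]; have [c uc] := trajectory_split n uU.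
exists c; rewrite -iter_linear_comb -addrA -iter_linearB.
exact: rpredD.
Qed.

Lemma trajectory_increments : exists d : nat -> nat,
  forall n, rel_dim (T n.+1) (T n.+2) (d n).
Proof. by have [d dP] := choice rel_dim_trajectoryS; exists d. Qed.

(** Telescoping along U = T_1 <= T_2 <= ... <= T_(n+1). *)
Lemma rel_dim_trajectory (d : nat -> nat) :
    (forall n, rel_dim (T n.+1) (T n.+2) (d n)) ->
  forall n, rel_dim U (T n.+1) (\sum_(k < n) d k)%N.
Proof.
move=> dP; elim=> [|n IH].
  rewrite big_ord0; exists (fun=> 0); split=> [[]//|c _ []//|x xT].
  by exists (fun=> 0); rewrite big_ord0 subr0; exact/trajectory1.
rewrite big_ord_recr /=; apply: rel_dim_add IH (dP n).
  exact: sub_trajectoryS.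
exact: trajectory_subS.
Qed.

(* phi maps T_(n+2) / T_(n+1) onto T_(n+3) / T_(n+2) *)
Lemma trajectory_increment_decr (d : nat -> nat) :
    (forall n, rel_dim (T n.+1) (T n.+2) (d n)) ->
  forall n, (d n.+1 <= d n)%N.
Proof.
move=> dP n; apply: (rel_dim_surj (f := phi) (dP n) (dP n.+1)) => [x|y].
  exact: trajectory_endo.
case/trajectoryS => t [u [tT uU ->]]; exists (iter n.+1 phi u).
  exact: iter_trajectory.
by rewrite addrK.
Qed.

(** Entropy is defined through [limn], so convergence must be known before two entropies can be
    compared termwise. *)
Lemma is_cvg_entropy_at (R : realType) : cvgn (fun n : nat =>
  ((n%:R^-1)%:E * dimension (subquotient (T n) U) R)%E).
Proof.
have [d dP] := trajectory_increments; have d_decr := trajectory_increment_decr dP.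
(* The value 0 at n = 0 accounts for T_1 / U = 0. With this shift, the mean of u_0, ..., u_n is
   exactly the entropy term of index n + 1. *)
pose u n : R := if n is m.+1 then (d m)%:R else 0.
have u_cvg : cvgn u.
  have dn : cvgn (fun n => (d n)%:R : R).
    apply: nonincreasing_is_cvgn.
      by apply/nonincreasing_seqP => n; rewrite ler_nat d_decr.
    by exists 0 => _ [n _ <-].
  by apply/cvg_ex; have /cvg_ex[l dl] := dn; exists l; rewrite -cvg_shiftS.
have /cvg_ex[l /cesaro ul] := u_cvg.
apply/cvg_ex; exists l%:E; rewrite -cvg_shiftS /=.
rewrite (_ : (fun n : nat => _) = EFin \o arithmetic_mean u).
  exact: cvg_comp ul _.
apply/funext => n; rewrite (dimension_subquotient R (rel_dim_trajectory dP n)) /=.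
rewrite -EFinM /arithmetic_mean /series /= big_mkord big_ord_recl /= add0r natr_sum.
by congr (_ * _)%:E.
Qed.

End TrajectoryDimension.

(** The spanning families make both sequences converge and all the dimensions finite, so that the
    termwise comparison passes to the limit. *)
Lemma entropy_at_le (R : realType) (K : fieldType) (V W : discTopLmodType K)
    (phi : {linear V -> V}) (psi : {linear W -> W})
    (U : submodClosed V) (U' : submodClosed W)
    (p q : nat) (e : 'I_p -> V) (f : 'I_q -> W) :
    spans_mod (preim_submod phi U) [set` U] e ->
    spans_mod (preim_submod psi U') [set` U'] f ->
    (forall n d d', rel_dim U (trajectory phi U n.+1) d ->
      rel_dim U' (trajectory psi U' n.+1) d' -> (d <= d')%N) ->
  (entropy_at R phi U <= entropy_at R psi U')%E.
Proof.
move=> se sf dle.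
apply: lee_lim.
- exact: (@is_cvg_entropy_at _ _ _ _ _ _ se R).
- exact: (@is_cvg_entropy_at _ _ _ _ _ _ sf R).
(* The comparison starts at index 1, as only the trajectories T_(n+1) contain [U]. *)
exists 1%N => // -[//|n] _ /=; apply: lee_wpmul2l; first by rewrite lee_fin.
have [d /rel_dim_trajectory/(_ n) dP] := trajectory_increments se.
have [d' /rel_dim_trajectory/(_ n) dP'] := trajectory_increments sf.
rewrite (dimension_subquotient R dP) (dimension_subquotient R dP') lee_fin ler_nat.
exact: dle dP dP'.
Qed.

(** * Trajectories of a restriction *)

Section RestrictTrajectory.
Variables (K : fieldType) (V : lmodType K) (phi : {linear V -> V}).
Variables (W : submodClosed V) (phiW : invariant_subspace phi W).
Local Notation psi := (restrict_endo phiW).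

Lemma val_iter_restrict n x : \val (iter n psi x) = iter n phi (\val x).
Proof. by elim: n => //= n ->. Qed.

Variables (U : submodClosed V) (U' : submodClosed (subspaceType W)).
Hypothesis trU : forall w, w \in U' <-> \val w \in U.

Lemma val_trajectory n x :
  x \in trajectory psi U' n -> \val x \in trajectory phi U n.
Proof.
elim: n x => [|n IH] x; first by move/trajectory0 ->; rewrite raddf0 rpred0.
case/trajectoryS => t [u [tT /trU uU ->]]; apply/trajectoryS.
by exists (\val t), (\val u); split=> //; [exact: IH|rewrite raddfD /= val_iter_restrict].
Qed.

Lemma rel_dim_restrict_le n d d' : rel_dim U' (trajectory psi U' n) d ->
  rel_dim U (trajectory phi U n) d' -> (d <= d')%N.
Proof.
move=> dP dP'; apply: (rel_dim_inj (f := \val) dP dP') => [x|x].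
  exact: val_trajectory.
by move/trU.
Qed.

Variables (p : nat) (e : 'I_p -> subspaceType W).
Hypothesis eU : forall i, e i \in U'.
Hypothesis spans_e : spans_mod (preim_submod phi U) [set` U] (\val \o e).

(** In t + phi^(n+1) u, the vector [u] is replaced by a combination of the [e i], which lie in [W].
    The error falls into T_(n+1), where induction applies. *)
Lemma trajectory_restrict_mod n x : x \in trajectory phi U n.+1 ->
  exists2 y, y \in trajectory psi U' n.+1 & x - \val y \in U.
Proof.
elim: n x => [|n IH] x.
  by move/trajectory1 => xU; exists 0; [exact: rpred0|rewrite raddf0 addr0].
case/trajectoryS => t [u [tT uU ->]]; have [c uc] := trajectory_split spans_e n uU.
have [y yT yU] := IH _ (rpredD tT uc).
pose z := \sum_i c i *: e i.
exists (y + iter n.+1 psi z).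
  rewrite rpredD//; first exact: trajectory_subS.
  apply: (@iter_trajectory _ _ _ _ n.+1); apply: rpred_sum => i _.
  by rewrite rpredZ.
have -> : \val (y + iter n.+1 psi z) =
    \val y + iter n.+1 phi (\sum_i c i *: \val (e i)).
  by rewrite (raddfD (\val : subspaceType W -> V)) /= val_iter_restrict linear_combination.
move: yU; rewrite iter_linearB opprD !addrA.
by rewrite [X in _ -> X \in _]addrAC.
Qed.

Lemma rel_dim_restrict_ge n d d' : rel_dim U (trajectory phi U n.+1) d ->
  rel_dim U' (trajectory psi U' n.+1) d' -> (d <= d')%N.
Proof.
move=> dP dP'; apply: (rel_dim_surj (f := \val) dP' dP) => [x /trU//|y].
exact: trajectory_restrict_mod.
Qed.

End RestrictTrajectory.

(** * Linear compactness relative to a class of subspaces *)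

Section Varieties.
Variables (K : fieldType) (V : lmodType K) (C : set (submodClosed V)).
Implicit Types (W : submodClosed V) (A : set V).

(* C is meant to be the class of closed linear subspaces. Families of varieties
   are indexed, so that carrying them along a map does not need any choice. *)
Definition variety A :=
  exists (v : V) W, C W /\ A = [set v + w | w in [set` W]].

Definition lin_compact_in (S : set V) :=
  forall (J : eqType) (P : set J) (F : J -> set V),
    (forall j, P j -> variety (F j)) ->
    (forall s : seq J, (forall j, j \in s -> P j) ->
      exists x, S x /\ forall j, j \in s -> F j x) ->
    exists x, S x /\ forall j, P j -> F j x.

Lemma variety_submod W :
  C W -> variety [set` W].
Proof.
move=> cW; exists 0, W; split=> //; apply/seteqP; split=> [x xW|_ [x xW <-]].
  by exists x; rewrite ?add0r.
by rewrite /= add0r.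
Qed.

Lemma variety_affine A a p q : variety A ->
  A p -> A q -> A (q + a *: (p - q)).
Proof.
move=> [v [W [_ ->]]] [x xW <-] [y yW <-].
exists (y + a *: (x - y)); first by rewrite /= rpredD ?rpredZ ?submodB.
by rewrite [- (v + y)]opprD [v + x + _]addrACA subrr add0r addrA.
Qed.

Lemma variety_shift A p : variety A ->
  variety [set v | A (v + p)].
Proof.
move=> [v [W [cW ->]]]; exists (v - p), W; split=> //.
apply/seteqP; split=> [x [w wW wx]|_ [w wW <-]].
  by exists w => //; rewrite addrAC wx addrK.
by exists w => //; rewrite -addrA [w + p]addrC addrA subrK.
Qed.

Lemma varietyE A x : A x -> variety A ->
  exists W, C W /\ A = [set y | y - x \in W].
Proof.
move=> Ax [v [W [cW AE]]]; exists W; split=> //.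
move: Ax; rewrite AE => -[w wW <-]; apply/seteqP; split=> [_ [u uW <-]|y /= yW].
  by rewrite /= opprD addrACA subrr add0r submodB.
exists (y - v); last by rewrite addrC subrK.
by rewrite /= -(subrK w (y - v)) rpredD// -addrA -opprD.
Qed.

(** [N] is itself a variety, so it can join the family, under the index [None]. *)
Lemma lin_compact_in_setI (S : set V) (N : submodClosed V) :
  C N -> lin_compact_in S -> lin_compact_in (S `&` [set` N]).
Proof.
move=> cN cS J P F Fv fip.
pose F' (o : option J) := if o is Some j then F j else [set` N].
pose P' (o : option J) := if o is Some j then P j else True.
have [[j Pj|_]|s sP|x [Sx xF]] := @cS _ P' F'.
- exact: Fv.
- exact: variety_submod.
- have [|x [[Sx Nx] xs]] := fip (pmap id s).
    by move=> j; rewrite mem_pmap map_id => /sP.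
  exists x; split=> // -[j js|_]; last exact: Nx.
  by apply: xs; rewrite mem_pmap map_id.
exists x; split; first by split=> //; exact: (xF None).
by move=> j Pj; exact: (xF (Some j)).
Qed.

(** Either the family has the finite intersection property inside [U], or some finite intersection
    misses [U]. In the latter case that intersection meets U + Kx within a single coset p + U, and
    translation by [p] reduces to [U]. *)
Lemma lin_compact_in_adjoin (U : submodClosed V) x : lin_compact_in [set` U] ->
  lin_compact_in [set y | exists a, y - a *: x \in U].
Proof.
move=> cU J P F Fv fip.
have [fipU|/existsNP[s0 /not_implyP[s0P s0U]]] := pselect (forall s : seq J,
    (forall j, j \in s -> P j) -> exists y, y \in U /\ forall j, j \in s -> F j y).
  have [y [yU yF]] := cU _ _ _ Fv fipU.
  by exists y; split=> //; exists 0; rewrite scale0r subr0.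
have [p [[a pU] ps0]] := fip _ s0P.
have meetU q b : q - b *: x \in U -> (forall j, j \in s0 -> F j q) -> q - p \in U.
  move=> qU qs0; have [ba|ba] := eqVneq b a.
    have := submodB qU pU; rewrite ba.
    by rewrite opprB addrA subrK.
  (* The scalar is chosen to cancel the coefficient of [x], so that this point of the line through
     [p] and [q] lies in [U]. *)
  case: s0U; exists (q + (b / (b - a)) *: (p - q)); split; last first.
    by move=> j js; apply: variety_affine;
      [exact/Fv/s0P|exact: ps0|exact: qs0].
  rewrite (_ : _ + _ = (q - b *: x) +
      (b / (b - a)) *: ((p - a *: x) - (q - b *: x))).
    by rewrite rpredD// rpredZ// submodB.
  rewrite (_ : p - _ - _ = (p - q) + (b - a) *: x); last first.
    by rewrite scalerBl opprB [b *: x - q]addrC addrACA [b *: x - _]addrC.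
  by rewrite [in RHS]scalerDr scalerA divfK ?subr_eq0// addrACA addNr addr0.
have [||y [yU yF]] := cU J P (fun j => [set v | F j (v + p)]).
- by move=> j /Fv; exact: variety_shift.
(* Adding [s0] to the finite subfamily forces the common point into p + U. *)
- move=> s sP; have [|q [[b qU] qs]] := fip (s ++ s0).
    by move=> j; rewrite mem_cat => /orP[/sP|/s0P].
  exists (q - p); split=> [|j js] /=.
    by apply: meetU qU _ => j js; apply: qs; rewrite mem_cat js orbT.
  by rewrite subrK; apply: qs; rewrite mem_cat js.
exists (y + p); split=> [|j Pj]; last exact: yF.
by exists a; rewrite -addrA rpredD.
Qed.

Section Codimension.
Variables U N : submodClosed V.
Hypothesis compactU : lin_compact_in [set` U].
Hypothesis C_over_N : forall W, {subset N <= W} -> C W.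

Section Sequence.
Variable e : nat -> V.
Hypothesis eU : forall k, e k \in U.
Hypothesis eN : forall k (c : nat -> K), e k - \sum_(i < k) c i *: e i \notin N.

(** A nonzero last coefficient would express the last vector through the earlier ones modulo [N],
    against [eN]. *)
Lemma sequence_free M (c : nat -> K) :
  \sum_(i < M) c i *: e i \in N -> forall i, (i < M)%N -> c i = 0.
Proof.
elim: M => // M IH; rewrite big_ord_recr /= => cN.
have [c0|c0] := eqVneq (c M) 0.
  move: cN; rewrite c0 scale0r addr0 => /IH ci i.
  by rewrite ltnS leq_eqVlt => /predU1P[->//|/ci].
case/negP: (eN M (fun i => - (c M)^-1 * c i)).
rewrite (_ : _ - _ = (c M)^-1 *: (\sum_(i < M) c i *: e i + c M *: e M)).
  by rewrite rpredZ.
rewrite addrC scalerDr scalerA mulVf// scale1r scaler_sumr; congr (_ + _).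
by rewrite -sumrN; apply: eq_bigr => i _; rewrite scalerA mulNr scaleNr opprK.
Qed.

(* v = \sum_j c_j e_j modulo N, where c has finite support *)
Definition coordinates (c : nat -> K) (v : V) := exists m, forall M,
  (m <= M)%N -> v - \sum_(i < M) c i *: e i \in N.

Lemma coordinates_linear a c d v w : coordinates c v -> coordinates d w ->
  coordinates (fun i => a * c i + d i) (a *: v + w).
Proof.
move=> [m cv] [m' dw]; exists (maxn m m') => M; rewrite geq_max => /andP[mM m'M].
rewrite (_ : _ - _ = a *: (v - \sum_(i < M) c i *: e i) +
  (w - \sum_(i < M) d i *: e i)); first by rewrite rpredD ?rpredZ ?cv ?dw.
under eq_bigr do rewrite scalerDl -scalerA.
by rewrite big_split /= -scaler_sumr opprD addrACA scalerBr.
Qed.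

Lemma coordinatesN v : v \in N -> coordinates (fun=> 0) v.
Proof.
by move=> vN; exists 0%N => M _; rewrite big1 ?subr0// => i _; rewrite scale0r.
Qed.

Lemma coordinates_zero c v : coordinates c v -> v \in N -> forall i, c i = 0.
Proof.
move=> [m cv] vN i; apply: (@sequence_free (maxn m i.+1)); last exact: leq_maxr.
by apply: submodBl (cv _ (leq_maxl _ _)) vN.
Qed.

Lemma coordinates_inj c d v : coordinates c v -> coordinates d v -> c =1 d.
Proof.
move=> cv dv i; apply/eqP; rewrite eq_sym -subr_eq0; apply/eqP.
have := coordinates_zero (coordinates_linear (-1) cv dv) _ i.
by rewrite scaleN1r addNr rpred0 mulN1r addrC => ->.
Qed.

Lemma coordinates_sum k : coordinates (fun i => (i < k)%:R) (\sum_(i < k) e i).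
Proof.
exists k => M kM; rewrite (_ : _ - _ = 0) ?rpred0//; apply/eqP; rewrite subr_eq0.
apply/eqP; rewrite [LHS](big_ord_widen _ e kM) [LHS]big_mkcond /=.
by apply: eq_bigr => i _; case: ltnP; rewrite ?scale1r ?scale0r.
Qed.

Definition tail_submod (k : nat) : submodClosed V.
Proof.
refine (@submod_of _ _ [set v | exists2 c, forall i, (i < k)%N -> c i = 0 &
  coordinates c v] _ _).
  by exists (fun=> 0) => //; apply: coordinatesN; exact: rpred0.
move=> a v w [c c0 cv] [d d0 dw]; exists (fun i => a * c i + d i).
  by move=> i ik; rewrite c0// d0// mulr0 addr0.
exact: coordinates_linear.
Defined.

Lemma tail_submodP k v : v \in tail_submod k <->
  exists2 c, forall i, (i < k)%N -> c i = 0 & coordinates c v.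
Proof. exact: submod_ofP. Qed.

(* The varieties e_0 + ... + e_(k-1) + W_k, where W_k is spanned by N and the
   e_j for j >= k, are nested, but a common point would have all its
   coordinates equal to 1. *)
Lemma no_free_sequence : False.
Proof.
pose F k := [set \sum_(i < k) e i + w | w in [set` tail_submod k]].
have [k _||x [_ xF]] := @compactU nat setT F.
- exists (\sum_(i < k) e i), (tail_submod k); split=> //; apply: C_over_N => v vN.
  by apply/tail_submodP; exists (fun=> 0) => //; exact: coordinatesN.
(* For each k in [s], the vector e_0 + ... + e_(M-1) differs from e_0 + ... + e_(k-1) by an element
   of the tail W_k. *)
- move=> s _; pose M := \max_(k <- s) k.
  exists (\sum_(i < M) e i); split; first exact: rpred_sum.
  move=> k ks; exists (-1 *: \sum_(i < k) e i + \sum_(i < M) e i); last first.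
    by rewrite scaleN1r addNKr.
  apply/tail_submodP; eexists; last first.
    exact: coordinates_linear (coordinates_sum k) (coordinates_sum M).
  move=> i ik; have kM : (k <= M)%N by rewrite /M (big_rem k ks) leq_maxl.
  by rewrite /= ik (leq_trans ik kM) mulr1 addNr.
have xc k : exists2 c, forall i, (i < k)%N -> c i = 1 & coordinates c x.
  have [w /tail_submodP[c c0 cw] <-] := xF k I.
  rewrite -[\sum_(i < k) e i]scale1r; eexists; last first.
    exact: coordinates_linear (coordinates_sum k) cw.
  by move=> i ik; rewrite /= ik mulr1 c0// addr0.
(* The partial sums of length m and m + 1 both represent [x] modulo [N], while its m-th coordinate
   is 1. Their difference e_m is then in [N]. *)
have [c _ cx] := xc 0%N; have [m cm] := cx.
have [d d1 dx] := xc m.+1.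
case/negP: (eN m (fun=> 0)); rewrite big1 ?subr0 => [|i _]; last by rewrite scale0r.
have := submodB (cm _ (leqnn m)) (cm _ (leqnSn m)).
rewrite big_ord_recr /= (coordinates_inj cx dx) d1// scale1r opprB.
rewrite [X in X \in _](_ : _ = e m)//.
by rewrite -[_ + e m - x]addrA [LHS]addrA subrK addrC subrK.
Qed.

End Sequence.

(** If no finite family of [U] spanned it modulo [N], a greedy choice would produce a sequence
    excluded by [no_free_sequence]. *)
Lemma lin_compact_in_codim : exists n (e : 'I_n -> V),
  (forall i, e i \in U) /\ spans_mod N [set` U] e.
Proof.
apply: contrapT => nfin.
(* [g] picks a vector of [U] independent modulo [N] of a given list. Its value 0 on lists that leave
   [U] is a default. *)
have /choice[g gP] : forall s : seq V, exists x, {subset s <= U} ->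
    x \in U /\ forall c : nat -> K, x - \sum_(i < size s) c i *: s`_i \notin N.
  move=> s; have [sU|nsU] := pselect ({subset s <= U}); last by exists 0.
  apply: contrapT => /forallNP sN; apply: nfin.
  exists (size s), (fun i => s`_i); split=> [i|x xU]; first exact/sU/mem_nth.
  apply: contrapT => /forallNP xN; apply: (sN x) => _; split=> // c.
  exact/negP/xN.
pose s k := iter k (fun s => rcons s (g s)) [::].
pose e k := g (s k).
have sE k : s k = mkseq e k by elim: k => //= k IH; rewrite mkseqS -IH.
have sU k : {subset s k <= U}.
  elim: k => [|k IH] x; first by rewrite in_nil.
  by rewrite /= mem_rcons inE => /predU1P[->|/IH//]; case: (gP _ IH).
apply: (@no_free_sequence e) => [k|k c]; first by case: (gP _ (sU k)).
have [_ /(_ c)] := gP _ (sU k).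
have -> : size (s k) = k by rewrite sE size_mkseq.
rewrite (eq_bigr (fun i : 'I_k => c i *: e i)) => // i _.
by rewrite sE nth_mkseq.
Qed.

End Codimension.

End Varieties.

Lemma nbhs_subr (G : topologicalZmodType) (x : G) (A : set G) :
  nbhs 0 A -> nbhs x [set y | A (y - x)].
Proof.
move=> A0; have sub_cont : {for x, continuous (fun y : G => y - x)}.
  apply: (@continuous_comp _ _ _ (fun y : G => (y, - x)) (fun z => z.1 + z.2)).
    by apply: cvg_pair; [exact: cvg_id|exact: cvg_cst].
  exact: add_continuous.
by apply: sub_cont; rewrite /= subrr.
Qed.

Section OpenSubspaces.
Variables (K : fieldType) (V : discTopLmodType K).
Implicit Types W N : submodClosed V.

Lemma nbhs0_open W : nbhs (0 : V) [set` W] -> open [set` W].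
Proof.
move=> W0; rewrite openE => x /= xW.
by apply: filterS (nbhs_subr x W0) => y /submodBr; exact.
Qed.

Lemma open_nbhs0 W : open [set` W] -> nbhs (0 : V) [set` W].
Proof. by move=> oW; apply: open_nbhs_nbhs; split=> //=; exact: rpred0. Qed.

(** The complement of a subspace is a union of its cosets, which are open. *)
Lemma open_closed W : open [set` W] -> closed [set` W].
Proof.
move=> oW; rewrite -openC openE => x /= xW.
by apply: filterS (nbhs_subr x (open_nbhs0 oW)) => y /submodBl yx /yx /xW.
Qed.

Lemma open_subset_submod N W : open [set` N] -> {subset N <= W} -> open [set` W].
Proof.
move=> oN NW; apply: nbhs0_open; apply: filterS NW _.
exact: open_nbhs0.
Qed.

Definition closed_submod : set (submodClosed V) := [set W | closed [set` W]].

(** Passage between sets of varieties with finite subsets, and indexed families with finite lists of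
    indices. *)
Lemma linearly_compactE :
  linearly_compact V <->
  linearly_topologized V /\ lin_compact_in closed_submod [set: V].
Proof.
split=> -[ltV cV]; split=> //.
  move=> J P F Fv fip.
  have [x xF] : \bigcap_(A in F @` P) A !=set0.
    apply: cV => [_ [j Pj <-]|D DF]; first exact: Fv.
    (* Only finitely many varieties have to be lifted to indices, so an induction on their
       enumeration suffices. *)
    have [t [tP tD]] : exists t : seq J, (forall j, j \in t -> P j) /\
        forall A, A \in finmap.enum_fset D -> exists2 j, j \in t & F j = A.
      have : forall A, A \in finmap.enum_fset D -> (F @` P) A.
        by move=> A /DF; rewrite inE.
      elim: (finmap.enum_fset D) => [_|A s IH As]; first by exists [::].
      have [|t [tP ts]] := IH; first by move=> B Bs; apply: As; rewrite inE Bs orbT.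
      have [j Pj jA] : (F @` P) A by apply: As; rewrite inE eqxx.
      exists (j :: t); split=> [k|B]; rewrite inE.
        by case/predU1P => [->|/tP].
      case/predU1P => [->|/ts[k kt <-]]; first by exists j; rewrite ?inE ?eqxx.
      by exists k; rewrite ?inE ?kt ?orbT.
    have [x [_ xt]] := fip _ tP; exists x => A /= /tD[j jt <-]; exact: xt.
  by exists x; split=> // j Pj; apply: xF; exists j.
(* Conversely, a set of varieties is a family indexed by itself. *)
move=> F Fv fip; have [|s sF|x [_ xF]] := @cV (set V) F id; first exact: Fv.
  have [|x xs] := fip (finmap.seq_fset tt s).
    by move=> A; rewrite finmap.seq_fsetE => /sF; rewrite inE.
  exists x; split=> // A As; apply: (xs A).
  by have := finmap.seq_fsetE tt s A; rewrite As /= => ->.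
by exists x.
Qed.

End OpenSubspaces.

(** * Closed subspaces *)

Section SubspaceVal.
Variables (K : fieldType) (V : lmodType K) (W : submodClosed V).
Implicit Types x y : subspaceType W.

Lemma subspace_valD x y : \val (x + y) = \val x + \val y.
Proof. exact: raddfD. Qed.

Lemma subspace_valB x y : \val (x - y) = \val x - \val y.
Proof. exact: raddfB. Qed.

Lemma subspace_valDK x y : \val (x + y) - \val x = \val y.
Proof. by rewrite subspace_valD addrC addKr. Qed.

End SubspaceVal.

Section ClosedSubspace.
Variables (K : fieldType) (V : discTopLmodType K) (W : submodClosed V).
Local Notation X := (subspace_discTopLmodType W).

Definition trace_sub (U : submodClosed V) : submodClosed X := @trace_pred K V W U.

Lemma trace_subP (U : submodClosed V) (x : X) :
  (x \in trace_sub U) = (\val x \in U).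
Proof. by []. Qed.

Lemma open_trace (U : submodClosed V) :
  open [set` U] -> open [set` trace_sub U].
Proof.
move=> oU; have /continuousP/(_ _ oU) := @subspace_val_continuous K V W.
by congr open.
Qed.

Lemma closed_trace (U : submodClosed V) :
  closed [set` U] -> closed [set` trace_sub U].
Proof.
rewrite -!openC => oU.
have /continuousP/(_ _ oU) := @subspace_val_continuous K V W.
by congr open.
Qed.

Lemma nbhs_subspace0 (A : set X) : nbhs (0 : X) A ->
  exists2 B : set V, nbhs (0 : V) B & forall x : X, B (\val x) -> A x.
Proof.
rewrite nbhsE; case=> O [[B oB <-] O0] OA; exists B => [|x Bx]; last exact: OA.
by apply: open_nbhs_nbhs; split.
Qed.

Lemma linearly_topologized_subspace :
  linearly_topologized V -> linearly_topologized X.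
Proof.
move=> [hV bV]; split=> [p q pq|N].
  apply: val_inj; apply: hV => A B Ap Bq.
  have [||x [Ax Bx]] := pq (\val @^-1` A) (\val @^-1` B).
  - exact: subspace_val_continuous Ap.
  - exact: subspace_val_continuous Bq.
  - by exists (\val x).
move=> /nbhs_subspace0[B /bV[U U0 UB] BN].
exists (trace_sub U); last by move=> x /UB /BN.
by apply: open_nbhs0; apply: open_trace; exact: nbhs0_open.
Qed.

Hypothesis closedW : closed [set` W].

Definition image_submod (U : submodClosed X) : submodClosed V.
Proof.
refine (@submod_of _ _ [set \val u | u in [set` U]] _ _).
  by exists 0; [exact: rpred0|exact: raddf0].
move=> a _ _ [x xU <-] [y yU <-]; exists (a *: x + y); last exact: linearP.
by rewrite /= rpredD// rpredZ.
Defined.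

(** A closed subset of the closed subspace [W] is closed in [V]: it is [W] minus an open set [B] of
    [V] that traces its complement. *)
Lemma closed_image_submod (U : submodClosed X) :
  closed [set` U] -> closed [set` image_submod U].
Proof.
rewrite -openC; case=> B oB BU.
suff -> : [set` image_submod U] = [set` W] `&` ~` B.
  by apply: closedI => //; exact: open_closedC.
have BP (x : X) : B (\val x) <-> ~ x \in U.
  by have := congr1 (fun A : set X => A x) BU; rewrite /= => ->.
apply/seteqP; split=> [x /submod_ofP[u uU <-]|x [xW nBx]].
  by split; [exact: valP|move/BP; exact].
apply/submod_ofP; exists (Sub x xW) => //=; apply: contrapT => xU; apply: nBx.
exact/(BP (Sub x xW)).
Qed.

Lemma variety_image (A : set X) :
  variety (@closed_submod K X) A -> variety (@closed_submod K V) (\val @` A).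
Proof.
move=> [v [U [cU ->]]]; exists (\val v), (image_submod U); split.
  exact: closed_image_submod.
apply/seteqP; split=> [_ [_ [u uU <-] <-]|_ [_ /submod_ofP[u uU <-] <-]].
  by exists (\val u); [apply/submod_ofP; exists u|rewrite raddfD].
by exists (v + u); [exists u|rewrite raddfD].
Qed.

Lemma variety_preimage (A : set V) (x : X) : A (\val x) ->
  variety (@closed_submod K V) A -> variety (@closed_submod K X) (\val @^-1` A).
Proof.
move=> Ax /(varietyE Ax)[U [cU ->]]; exists x, (trace_sub U); split.
  exact: closed_trace.
apply/seteqP; split=> [y /= yU|_ [u uU <-]] /=.
  by exists (y - x); [rewrite /= trace_subP raddfB|rewrite addrC subrK].
have := subspace_valDK x u => /= ->; exact: uU.
Qed.

Lemma lin_compact_in_val (S : set X) :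
  lin_compact_in (@closed_submod K X) S <->
  lin_compact_in (@closed_submod K V) (\val @` S).
Proof.
split=> cS J P F Fv fip.
  have [||x [Sx xF]] := cS J P (fun j => \val @^-1` F j).
  (* A preimage is a variety only if it is nonempty; the finite intersection property for the
     singleton list provides a point. *)
  - move=> j Pj; have [k|_ [[x Sx <-] xF]] := fip [:: j].
      by rewrite inE => /eqP ->.
    by apply: variety_preimage (Fv _ Pj); apply: xF; rewrite inE.
  - by move=> s /fip[_ [[x Sx <-] xs]]; exists x.
  by exists (\val x); split=> //; exists x.
have [||_ [[x Sx <-] xF]] := cS J P (fun j => \val @` F j).
- by move=> j /Fv; exact: variety_image.
- by move=> s /fip[x [Sx xs]]; exists (\val x); split=> [|j /xs]; exists x.
by exists x; split=> // j /xF[y yF /val_inj <-].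
Qed.

End ClosedSubspace.

(** * Linearly compact open subspaces *)

Section LinearlyCompactOpen.
Variables (K : fieldType) (V : discTopLmodType K).
Hypothesis ltV : linearly_topologized V.

(** An open subspace is closed, so its compactness can be tested on varieties of [V] itself, without
    its induced structure. *)
Lemma lc_open_subspacesP (U : submodClosed V) : lc_open_subspaces V U <->
  open [set` U] /\ lin_compact_in (@closed_submod K V) [set` U].
Proof.
have valT : [set \val u | u in [set: subspaceType U]] = [set` U].
  apply/seteqP; split=> [_ [u _ <-]|x xU]; first exact: valP.
  by exists (Sub x xU).
split; move=> [oU]; have cU := open_closed oU.
  by move=> /linearly_compactE[_ /(lin_compact_in_val cU)]; rewrite valT.
move=> kU; split=> //; apply/linearly_compactE; split.
  exact: linearly_topologized_subspace.
by apply/(lin_compact_in_val cU); rewrite valT.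
Qed.

End LinearlyCompactOpen.

Section AdjoinSubmod.
Variables (K : fieldType) (V : lmodType K).
Implicit Types U N : submodClosed V.

Definition adjoin_submod U (x : V) : submodClosed V.
Proof.
refine (@submod_of _ _ [set y | exists a, y - a *: x \in U] _ _).
  by exists 0; rewrite scale0r subr0 rpred0.
move=> a y z [b yU] [c zU]; exists (a * b + c).
rewrite (_ : _ - _ = a *: (y - b *: x) + (z - c *: x)).
  by rewrite rpredD// rpredZ.
by rewrite scalerBr scalerA addrACA -opprD -scalerDl.
Defined.

Lemma adjoin_submodP U x y :
  y \in adjoin_submod U x <-> exists a, y - a *: x \in U.
Proof. exact: submod_ofP. Qed.

Lemma adjoin_submod_sub U x : {subset U <= adjoin_submod U x}.
Proof.
by move=> y yU; apply/adjoin_submodP; exists 0; rewrite scale0r subr0.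
Qed.

Lemma adjoin_submod_mem U x : x \in adjoin_submod U x.
Proof. by apply/adjoin_submodP; exists 1; rewrite scale1r subrr rpred0. Qed.

Definition cap_submod U N : submodClosed V.
Proof.
refine (@submod_of _ _ ([set` U] `&` [set` N]) _ _).
  by split; rewrite /= rpred0.
by move=> a y z [/= yU yN] [/= zU zN]; split; rewrite /= rpredD ?rpredZ.
Defined.

Lemma set_submod_of P P0 PL : [set` @submod_of K V P P0 PL] = P.
Proof. by apply/seteqP; split=> x /(submod_ofP P0 PL). Qed.

End AdjoinSubmod.

Section LinearlyCompactSubspaces.
Variables (K : fieldType) (V : discTopLmodType K).
Hypothesis ltV : linearly_topologized V.
Implicit Types U N : submodClosed V.

Lemma lc_open_cap U N : lc_open_subspaces V U -> open [set` N] ->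
  lc_open_subspaces V (cap_submod U N).
Proof.
move=> /(lc_open_subspacesP ltV)[oU cU] oN; apply/(lc_open_subspacesP ltV).
rewrite set_submod_of; split; first exact: openI.
apply: lin_compact_in_setI => //; exact: open_closed.
Qed.

Lemma lc_open_adjoin U x : lc_open_subspaces V U ->
  lc_open_subspaces V (adjoin_submod U x).
Proof.
move=> /(lc_open_subspacesP ltV)[oU cU]; apply/(lc_open_subspacesP ltV); split.
  by apply: open_subset_submod oU _; exact: adjoin_submod_sub.
by rewrite set_submod_of; exact: lin_compact_in_adjoin.
Qed.

Lemma lc_open_adjoin_family U n (e : 'I_n -> V) : lc_open_subspaces V U ->
  exists U', [/\ lc_open_subspaces V U', {subset U <= U'},
    forall i, e i \in U' & spans_mod U [set` U'] e].
Proof.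
move=> lcU; elim: n e => [|n IH] e.
  exists U; split=> // [[]//|x xU]; exists (fun=> 0).
  by rewrite big_ord0 subr0.
have [U1 [lcU1 UU1 eU1 sU1]] := IH (fun i => e (lift ord0 i)).
exists (adjoin_submod U1 (e ord0)); split.
- exact: lc_open_adjoin.
- by move=> x /UU1; exact: adjoin_submod_sub.
- move=> i; case: (unliftP ord0 i) => [j|] ->; last exact: adjoin_submod_mem.
  exact: adjoin_submod_sub.
move=> x /adjoin_submodP[a /sU1[c xc]].
exists (fun i => oapp c a (unlift ord0 i)).
rewrite big_ord_recl unlift_none /= opprD addrA.
by under eq_bigr do rewrite liftK.
Qed.

(** Every subspace that contains an open one is open, hence closed, as [lin_compact_in_codim]
    requires. *)
Lemma lc_open_codim U N : lc_open_subspaces V U -> open [set` N] ->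
  exists n (e : 'I_n -> V), (forall i, e i \in U) /\ spans_mod N [set` U] e.
Proof.
move=> /(lc_open_subspacesP ltV)[oU cU] oN.
apply: (lin_compact_in_codim cU) => W NW.
by apply: open_closed; exact: open_subset_submod NW.
Qed.

Lemma lc_open_almost_invariant U (phi : {linear V -> V}) :
  continuous phi -> lc_open_subspaces V U ->
  exists n (e : 'I_n -> V),
    (forall i, e i \in U) /\ spans_mod (preim_submod phi U) [set` U] e.
Proof.
move=> phi_cont lcU; apply: lc_open_codim => //.
rewrite set_submod_of.
by move/continuousP : phi_cont => /(_ [set` U] lcU.1).
Qed.

End LinearlyCompactSubspaces.

(** * Traces on a closed subspace *)

Section ClosedInvariant.
Variables (K : fieldType) (V : discTopLmodType K).
Hypothesis V_llc : locally_linearly_compact V.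
Variable W : submodClosed V.
Hypothesis closedW : closed [set` W].

Let ltV : linearly_topologized V := V_llc.1.
Let ltW : linearly_topologized (subspaceType W) :=
  linearly_topologized_subspace W ltV.

Lemma lc_open_trace U : lc_open_subspaces V U ->
  lc_open_subspaces (subspaceType W) (trace_sub W U).
Proof.
move=> /(lc_open_subspacesP ltV)[oU cU]; apply/(lc_open_subspacesP ltW); split.
  exact: open_trace.
apply/(lin_compact_in_val closedW).
rewrite (_ : _ @` _ = [set` U] `&` [set` W]); first exact: lin_compact_in_setI.
apply/seteqP; split=> [_ [x xU <-]|x [xU xW]]; first by split=> //; exact: valP.
by exists (Sub x xW).
Qed.

(* With U0 open and small enough that U0 `&` W is included in U', the subspace
   U := U0 + U' has trace U' on W by the modular law. It is linearly compact
   since U' has finite dimension modulo U0. *)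
Lemma lc_open_trace_surj (U' : submodClosed (subspaceType W)) :
  lc_open_subspaces (subspaceType W) U' -> exists2 U, lc_open_subspaces V U &
    forall w, w \in U' <-> \val w \in U.
Proof.
move=> lcU'; have [B B0 BU'] := nbhs_subspace0 (open_nbhs0 lcU'.1).
have [N N0 NB] := ltV.2 _ B0.
have [U1 lcU1] := V_llc.2.
pose U0 := cap_submod U1 N.
have lcU0 : lc_open_subspaces V U0 by apply: lc_open_cap => //; exact: nbhs0_open.
have trU0 (w : subspaceType W) : \val w \in U0 -> w \in U'.
  by move=> /submod_ofP[_ wN]; apply: BU'; exact: NB.
have [n [e [eU' se]]] := lc_open_codim ltW lcU' (open_trace W lcU0.1).
have [U [lcU U0U eU sU]] := lc_open_adjoin_family ltV (fun i => \val (e i)) lcU0.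
have combE (w : subspaceType W) (c : 'I_n -> K) :
    \val (w - \sum_i c i *: e i) = \val w - \sum_i c i *: \val (e i).
  by rewrite subspace_valB linear_combination.
exists U => // w; split=> [/se[c]|/sU[c wc]].
  rewrite trace_subP combE => /U0U /submodBr; apply.
  by apply: rpred_sum => i _; rewrite rpredZ.
(* The modular law: this difference lies in [W] and in [U0], hence in [U'], and so does the sum. *)
have /submodBr : w - \sum_i c i *: e i \in U' by apply: trU0; rewrite combE.
by apply; apply: rpred_sum => i _; rewrite rpredZ.
Qed.

Lemma restrict_endo_continuous (phi : {linear V -> V})
    (phiW : invariant_subspace phi W) :
  continuous phi -> continuous (restrict_endo phiW : subspaceType W -> _).
Proof.
move=> phi_cont; apply: continuous_subspace => x.
apply: (@continuous_comp _ _ _ (\val : subspaceType W -> V) phi).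
  exact: subspace_val_continuous.
exact: phi_cont.
Qed.

End ClosedInvariant.

(** * Entropy of a direct limit *)

Lemma directed_family_finite (K : fieldType) (V : lmodType K) (I : Type)
    (Vs : I -> submodClosed V) (n : nat) (e : 'I_n -> V) :
    directed_family Vs -> \bigcup_(i in [set: I]) [set` Vs i] = [set: V] ->
  exists i, forall j, e j \in Vs i.
Proof.
move=> Vs_dir Vs_cov.
have cover x : exists i, x \in Vs i.
  by have : [set: V] x by []; rewrite -Vs_cov => -[i _ xi]; exists i.
(* Even the empty family requires an index, which the covering of 0 provides. *)
elim: n e => [|n IH] e; first by have [i _] := cover 0; exists i => -[].
have [i ei] := IH (fun j => e (lift ord0 j)); have [k ek] := cover (e ord0).
have [l [il kl]] := Vs_dir i k; exists l => j.
by case: (unliftP ord0 j) => [m|] ->; [exact: il|exact: kl].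
Qed.

Theorem proposition4p5 (R : realType) (K : fieldType) (V : discTopLmodType K)
    (V_llc : locally_linearly_compact V)
    (phi : {linear V -> V}) (phi_cont : continuous phi)
    (I : Type) (Vs : I -> submodClosed V)
    (Vs_closed : forall i, closed [set` Vs i])
    (Vs_inv : forall i, invariant_subspace phi (Vs i))
    (Vs_directed : directed_family Vs)
    (Vs_cover : \bigcup_(i in [set: I]) [set` Vs i] = [set: V]) :
  ent R phi = ereal_sup (range (fun i : I => ent R (restrict_endo (Vs_inv i)))).
Proof.
have ltV := V_llc.1.
have ltVs i := linearly_topologized_subspace (Vs i) ltV.
have phi_i_cont i := restrict_endo_continuous (phiW := Vs_inv i) phi_cont.
apply/eqP; rewrite eq_le; apply/andP; split; last first.
  (* The restrictions have entropy at most that of [phi]: each [U'] is the trace of some [U], and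
     the inclusion is injective on the quotients. *)
  apply: ge_ereal_sup => _ [i _ <-]; apply: ge_ereal_sup => _ [U' lcU' <-].
  have [U lcU UU'] := lc_open_trace_surj V_llc lcU'.
  have [p [e [_ se]]] := lc_open_almost_invariant ltV phi_cont lcU.
  have [q [f [_ sf]]] := lc_open_almost_invariant (ltVs i) (@phi_i_cont i) lcU'.
  apply: (le_trans (entropy_at_le R sf se _)).
    by move=> n d d'; exact: rel_dim_restrict_le.
  by apply: ereal_sup_ubound; exists U.
(* Conversely, the index [i] depends on [U]: it is chosen so that V_i contains the finitely many
   [e j] that control all trajectories of [U]. *)
apply: ge_ereal_sup => _ [U lcU <-].
have [p [e [eU se]]] := lc_open_almost_invariant ltV phi_cont lcU.
have [i ei] := directed_family_finite e Vs_directed Vs_cover.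
have lcU' := lc_open_trace V_llc (Vs_closed i) lcU.
have [q [f [_ sf]]] := lc_open_almost_invariant (ltVs i) (@phi_i_cont i) lcU'.
apply: (@le_trans _ _ (ent R (restrict_endo (Vs_inv i)))); last first.
  by apply: ereal_sup_ubound; exists i.
pose U' := trace_sub (Vs i) U.
apply: (@le_trans _ _ (entropy_at R (restrict_endo (Vs_inv i)) U')).
  apply: (entropy_at_le R se sf) => n d d'.
  by apply: (rel_dim_restrict_ge _ (e := fun j => Sub (e j) (ei j))).
by apply: ereal_sup_ubound; exists U'.
Qed.
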